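(* Let $G$ be a simple connected undirected graph of order $n\ge 2$ that is $r$-regular and $k$-resistance regular. Then the double graph $D_2G$ satisfies $$E_R(D_2G)=\rho_1(G)+\frac{2n}{r},$$ where $\rho_1(G)$ is the largest eigenvalue of the resistance distance matrix of $G$.
   Context: For a connected graph $G$ with vertices $v_1,\dots,v_n$, Laplacian matrix $L$ (degree matrix minus adjacency matrix) and Moore-Penrose inverse $L^\dagger=(l^\dagger_{ij})$, the resistance distance is $r_{ij}=l^\dagger_{ii}+l^\dagger_{jj}-2l^\dagger_{ij}$, and the resistance distance matrix is $R(G)=(r_{ij})$. $G$ is $k$-resistance regular if every row sum of $R(G)$ equals $k$; it is $r$-regular if every vertex has degree $r$. The resistance energy $E_R(G)$ is the sum of the absolute values of the eigenvalues of $R(G)$, counted with multiplicity. The double graph $D_2G$ of a graph $G$ with vertices $v_1,\dots,v_n$ is obtained by taking $G$ together with another copy of $G$ on vertices $v_1',\dots,v_n'$ ($v_i'$ corresponding to $v_i$) and joining, for each $i$, $v_i'$ to every vertex in the neighborhood $N(v_i)$ of $v_i$ in $G$. *)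

(* Defs.v *)
From HB Require Import structures.
From mathcomp Require Import all_boot all_order all_algebra.
From mathcomp Require Import polyrcf complex.

Set Implicit Arguments.
Unset Strict Implicit.
Unset Printing Implicit Defensive.

Import Order.TTheory GRing.Theory Num.Theory.
Local Open Scope ring_scope.

Record sgraph (n : nat) := SGraph {
  adj :> rel 'I_n;
  adj_sym : symmetric adj;
  adj_irr : irreflexive adj
}.

Definition connected_graph n (G : sgraph n) := forall i j, connect G i j.

Definition degree n (G : sgraph n) (i : 'I_n) : nat := #|[set j | G i j]|.

Definition regular_graph n (G : sgraph n) (r : nat) :=
  forall i, degree G i = r.

(* In 'I_(n + n), lshift n i stands for v_i and rshift n i for v_i'. *)
Definition double_adj n (G : sgraph n) : rel 'I_(n + n) := fun x y =>
  match split x, split y with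
  | inl i, inl j => G i j
  | inr i, inr j => G i j
  | inr i, inl j => G i j
  | inl i, inr j => G j i
  end.

Lemma double_adj_sym n (G : sgraph n) : symmetric (double_adj G).
Proof.
move=> x y; rewrite /double_adj.
by case: (split x) => i; case: (split y) => j //; rewrite adj_sym.
Qed.

Lemma double_adj_irr n (G : sgraph n) : irreflexive (double_adj G).
Proof. by move=> x; rewrite /double_adj; case: (split x) => i; apply: adj_irr. Qed.

Definition double_graph n (G : sgraph n) : sgraph (n + n) :=
  SGraph (double_adj_sym G) (double_adj_irr G).

(* The four Penrose equations; the Moore-Penrose inverse mpinv below is their
   unique solution. The field is real, so the adjoint is the transpose. *)
Definition penrose (R : rcfType) m n (A : 'M[R]_(m, n)) (X : 'M[R]_(n, m)) :=
  [&& A *m X *m A == A, X *m A *m X == X,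
      (A *m X)^T == A *m X & (X *m A)^T == X *m A].

Lemma row_mul_tr_eq0 (R : rcfType) n (u : 'rV[R]_n) :
  u *m u^T = 0 -> u = 0.
Proof.
move=> /matrixP/(_ 0 0); rewrite !mxE => s0.
apply/rowP => j; rewrite mxE; apply/eqP; rewrite -sqrf_eq0 expr2.
have /psumr_eq0P s0' : \sum_j u 0 j * u 0 j = 0.
  by rewrite -[RHS]s0; apply: eq_bigr => i _; rewrite mxE.
by apply/eqP; apply: s0' => // i _; rewrite -expr2 sqr_ge0.
Qed.

Lemma gram_unit (R : rcfType) m n (A : 'M[R]_(m, n)) :
  row_free A -> A *m A^T \in unitmx.
Proof.
move=> Afree; rewrite -row_free_unit -kermx_eq0; apply/rowV0P => v.
move/sub_kermxP => vAA; apply: (row_free_inj Afree); rewrite mul0mx.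
apply: row_mul_tr_eq0.
by rewrite trmx_mul mulmxA -(mulmxA v) vAA mul0mx.
Qed.

Lemma penrose_exists (R : rcfType) m n (A : 'M[R]_(m, n)) :
  exists X, penrose A X.
Proof.
have Bfree : row_free (col_base A)^T.
  by rewrite /row_free mxrank_tr; exact: col_base_full.
have uC := gram_unit (row_base_free A); have uB := gram_unit Bfree.
rewrite trmxK in uB; have eA := mulmx_base A.
move: (col_base A) (row_base A) uB uC eA => B C uB uC <-.
have sB : (B^T *m B)^T = B^T *m B by rewrite trmx_mul trmxK.
have sC : (C *m C^T)^T = C *m C^T by rewrite trmx_mul trmxK.
exists (C^T *m invmx (C *m C^T) *m invmx (B^T *m B) *m B^T).
have AX : B *m C *m (C^T *m invmx (C *m C^T) *m invmx (B^T *m B) *m B^T)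
        = B *m invmx (B^T *m B) *m B^T.
  by rewrite !mulmxA -(mulmxA B) -(mulmxA B) mulmxV // mulmx1.
have XA : C^T *m invmx (C *m C^T) *m invmx (B^T *m B) *m B^T *m (B *m C)
        = C^T *m invmx (C *m C^T) *m C.
  by rewrite !mulmxA -(mulmxA _ B^T B) -(mulmxA _ (invmx (B^T *m B))) mulVmx // mulmx1.
apply/and4P; split; apply/eqP.
- by rewrite AX !mulmxA -(mulmxA _ B^T B) -(mulmxA B) mulVmx // mulmx1.
- rewrite XA !mulmxA -(mulmxA _ C C^T) -(mulmxA C^T) mulVmx // mulmx1 //.
- by rewrite AX !trmx_mul trmxK trmx_inv sB mulmxA.
- by rewrite XA !trmx_mul trmxK trmx_inv sC mulmxA.
Qed.

Definition mpinv (R : rcfType) m n (A : 'M[R]_(m, n)) : 'M[R]_(n, m) :=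
  xchoose (penrose_exists A).

Lemma mpinvP (R : rcfType) m n (A : 'M[R]_(m, n)) : penrose A (mpinv A).
Proof. exact: xchooseP. Qed.

Lemma penrose_uniq (R : rcfType) m n (A : 'M[R]_(m, n)) X Y :
  penrose A X -> penrose A Y -> X = Y.
Proof.
case/and4P=> /eqP X1 /eqP X2 /eqP X3 /eqP X4.
case/and4P=> /eqP Y1 /eqP Y2 /eqP Y3 /eqP Y4.
have eAX : A *m X = A *m Y.
  by rewrite -X3 -{1}Y1 -(mulmxA _ A X) trmx_mul X3 Y3 mulmxA X1.
have eXA : X *m A = Y *m A.
  by rewrite -X4 -{1}Y1 !mulmxA -(mulmxA (X *m A)) trmx_mul X4 Y4
             -mulmxA (mulmxA A) X1.
by rewrite -X2 eXA -mulmxA eAX mulmxA Y2.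
Qed.

Definition adjacency_matrix (R : rcfType) n (G : sgraph n) : 'M[R]_n :=
  \matrix_(i, j) (G i j)%:R.

Definition laplacian (R : rcfType) n (G : sgraph n) : 'M[R]_n :=
  diag_mx (\row_i (degree G i)%:R) - adjacency_matrix R G.

Definition resistance_matrix (R : rcfType) n (G : sgraph n) : 'M[R]_n :=
  let Ld := mpinv (laplacian R G) in
  \matrix_(i, j) (Ld i i + Ld j j - 2 * Ld i j).

Definition resistance_regular (R : rcfType) n (G : sgraph n) (k : R) :=
  forall i, \sum_j resistance_matrix R G i j = k.

(* Eigenvalues in R, repeated according to their multiplicity as roots of the
   characteristic polynomial, in decreasing order. Non-real eigenvalues are
   not listed; a symmetric matrix has none (spectrum_sym). *)

Definition spectrum (R : rcfType) n (M : 'M[R]_n) : seq R :=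
  let p := char_poly M in
  sort >=%R (flatten [seq nseq (mup x p) x | x <- rootsR p]).

Definition largest_eigenvalue (R : rcfType) n (M : 'M[R]_n) : R :=
  head 0 (spectrum M).

Definition resistance_energy (R : rcfType) n (G : sgraph n) : R :=
  \sum_(x <- spectrum (resistance_matrix R G)) `|x|.

Lemma mup_prod (R : rcfType) (s : seq R) x :
  mup x (\prod_(y <- s) ('X - y%:P)) = count_mem x s.
Proof.
elim: s => [|y s IHs]; first by rewrite big_nil mupNroot // root1.
rewrite big_cons mupM ?polyXsubC_eq0 ?monic_neq0 ?monic_prod_XsubC // IHs /=.
by rewrite -[X in mup x X]expr1 mup_XsubCX; case: (y == x).
Qed.

Lemma eigenvalue_sym_real (R : rcfType) n (M : 'M[R]_n) (z : R[i]) :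
  M^T = M -> root (char_poly (map_mx (real_complex R) M)) z ->
  exists x : R, z = x%:C%C.
Proof.
move=> sM; rewrite -eigenvalue_root_char => /eigenvalueP [v vM v0].
set Mc := map_mx _ M in vM; set w := map_mx (@conjc R) v.
have cM : map_mx (@conjc R) Mc = Mc.
  by apply/matrixP => i j; rewrite !mxE conjc_real.
have sMc : Mc^T = Mc by apply/matrixP => i j; rewrite !mxE; have := congr1 (fun N : 'M_n => N i j) sM; rewrite mxE => ->.
have wM : w *m Mc = z^*%C *: w by rewrite -cM -map_mxM vM map_mxZ.
have nz : (v *m w^T) 0 0 != 0.
  rewrite mxE; apply: contra v0 => /eqP s0; apply/eqP/rowP => j.
  rewrite mxE; apply/eqP; rewrite -normr_eq0 -sqrf_eq0 sqr_normc.
  apply/eqP; have /psumr_eq0P H : \sum_j v 0 j * (v 0 j)^*%C = 0.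
    by rewrite -[RHS]s0; apply: eq_bigr => i _; rewrite !mxE.
  by apply: H => // i _; rewrite -sqr_normc exprn_ge0.
have e1 : v *m Mc *m w^T = z *: (v *m w^T) by rewrite vM -scalemxAl.
have e2 : v *m Mc *m w^T = z^*%C *: (v *m w^T).
  by rewrite -mulmxA -{1}sMc -trmx_mul wM linearZ /= -scalemxAr.
have /eqP : z * (v *m w^T) 0 0 = z^*%C * (v *m w^T) 0 0.
  by have := congr1 (fun N : 'M_1 => N 0 0) (etrans (esym e1) e2); rewrite !mxE.
rewrite (inj_eq (mulIf nz)).
case: z {vM wM e1 e2} => a b /eqP [] /eqP; rewrite -addr_eq0 -mulr2n.
rewrite mulrn_eq0 /= => /eqP ->; by exists a.
Qed.

Lemma spectrum_sym (R : rcfType) n (M : 'M[R]_n) :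
  M^T = M -> char_poly M = \prod_(x <- spectrum M) ('X - x%:P).
Proof.
move=> sM; pose Mc := map_mx (real_complex R) M.
have [s ps] : exists s : seq R, char_poly M = \prod_(x <- s) ('X - x%:P).
  have [t] := closed_field_poly_normal (char_poly Mc).
  rewrite (monicP (char_poly_monic _)) scale1r => pt.
  have rt z : z \in t -> z = (complex.Re z)%:C%C.
    move=> zt; case: (@eigenvalue_sym_real _ _ M z sM) => [|x -> //].
    by rewrite -/Mc pt root_prod_XsubC.
  exists (map (@complex.Re R) t).
  apply: (map_poly_inj (real_complex R)).
  rewrite map_char_poly -/Mc pt rmorph_prod big_map big_seq [RHS]big_seq.
  apply: eq_bigr => z zt.
  by rewrite rmorphB /= map_polyX map_polyC /= -rt.
rewrite {1}ps; apply: perm_big; rewrite /spectrum perm_sym perm_sort ps.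
set p := \prod_(_ <- s) _.
have p0 : p != 0 by rewrite monic_neq0 // monic_prod_XsubC.
apply/allP => x _ /=; apply/eqP.
rewrite count_flatten -map_comp sumnE big_map.
under eq_bigr do rewrite /= count_nseq /= eq_sym.
have ur : uniq (rootsR p) by exact: uniq_roots.
have xr : (x \in rootsR p) = (x \in s).
  by rewrite -roots_on_rootsR // in_itv /= root_prod_XsubC.
have [xs|xs] := boolP (x \in s).
  rewrite (bigD1_seq x) ?xr //= eqxx mul1n mup_prod big1 ?addn0 // => y.
  by rewrite eq_sym => /negPf ->.
rewrite (count_memPn xs) big1_seq // => y /andP [_ yr].
by case: eqP => // e; move: xs; rewrite -xr e yr.
Qed.

Lemma mem_spectrum (R : rcfType) n (M : 'M[R]_n) x :
  (x \in spectrum M) = eigenvalue M x.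
Proof.
rewrite /spectrum mem_sort eigenvalue_root_char.
set p := char_poly M; have p0 : p != 0 by rewrite monic_neq0 ?char_poly_monic.
have rp y : (y \in rootsR p) = root p y by rewrite -roots_on_rootsR // in_itv.
apply/flatten_mapP/idP => [[y]|px].
  by rewrite rp mem_nseq => py /andP [_ /eqP ->].
by exists x; rewrite ?rp // mem_nseq eqxx andbT mup_geq // expr1 -root_factor_theorem.
Qed.

Lemma largest_eigenvalue_ge (R : rcfType) n (M : 'M[R]_n) x :
  eigenvalue M x -> x <= largest_eigenvalue M.
Proof.
rewrite -mem_spectrum /largest_eigenvalue.
have : sorted >=%R (spectrum M) by apply: sort_sorted => a b; apply: le_total.
case: (spectrum M) => //= y s /(order_path_min (fun _ _ _ h1 h2 => le_trans h2 h1)).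
by rewrite inE => /allP h /orP [/eqP ->|/h].
Qed.

(* Main.v *)
Require Import Defs.
From mathcomp Require Import all_boot all_order all_algebra.
From mathcomp Require Import ring.

Set Implicit Arguments.
Unset Strict Implicit.
Unset Printing Implicit Defensive.

Import Order.TTheory GRing.Theory Num.Theory.
Local Open Scope ring_scope.

(** Write [L] for the Laplacian of a graph, [X] for its Moore-Penrose inverse
    and [J] for the all-ones matrix. The rows of [X] sum to zero, so the [i]-th
    row of the resistance matrix of a graph on [n] vertices sums to
    [n * X i i + \tr X]. A resistance regular graph therefore has a constant
    diagonal [X i i = d], and its resistance matrix is [2 d J - 2 X].

    Both [2 d J] and [2 X] are positive semidefinite and their product is zero.
    Energy (the sum of the absolute values of the eigenvalues) is additive over
    symmetric matrices with zero product (matrix_energy_add_orth), and the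
    energy of a matrix that is positive semidefinite, up to sign, is read off
    from its trace. Hence the resistance energy is [2 d n + 2 n d = 4 n d]
    (resistance_energy_const_diag). On the all-ones vector the resistance matrix
    acts as [k = 2 d n], and every eigenvector for another eigenvalue is
    orthogonal to it, where the matrix is [- 2 X] and the eigenvalue at most
    [0 <= k]; so the largest eigenvalue is [k] (largest_resistance_eigenvalue).

    It remains to see that the double graph of an [r]-regular graph again has a
    constant diagonal. Its Laplacian acts as [2 L] on the vectors [(x, x)] and
    as [2 r] on the vectors [(x, - x)], so its Moore-Penrose inverse acts as
    [X / 2] and [1 / (2 r)] there (mpinv_laplacian_double), and has the constant
    diagonal [d / 4 + 1 / (4 r)]. The energy of the double graph is thus
    [4 (2 n) (d / 4 + 1 / (4 r)) = 2 n d + 2 n / r = k + 2 n / r]. *)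

(** * Spectra of symmetric matrices *)

(** The sum of the absolute values of the eigenvalues in [R], with multiplicity;
    all eigenvalues are counted when the matrix is symmetric. *)
Definition matrix_energy (R : rcfType) n (M : 'M[R]_n) : R :=
  \sum_(x <- spectrum M) `|x|.

Lemma size_spectrum_sym (R : rcfType) n (M : 'M[R]_n) :
  M^T = M -> size (spectrum M) = n.
Proof.
move=> /spectrum_sym eM; apply: succn_inj.
by rewrite -(size_char_poly M) eM size_prod_XsubC.
Qed.

Lemma sum_spectrum_sym (R : rcfType) n (M : 'M[R]_n) :
  M^T = M -> \sum_(x <- spectrum M) x = \tr M.
Proof.
move=> sM; have szM := size_spectrum_sym sM.
case: (posnP n) => [n0|n_gt0].
  have /size0nil -> : size (spectrum M) = 0%N by rewrite szM.
  by rewrite big_nil /mxtrace big1 // => i; have := ltn_ord i; rewrite {2}n0.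
apply: oppr_inj; rewrite -(char_poly_trace M n_gt0).
rewrite (spectrum_sym sM) -[X in _`_X.-1]szM coefPn_prod_XsubC //.
by rewrite szM -lt0n.
Qed.

(** When [A B = 0], the product of ['X - A] and ['X - B] is
    ['X * ('X - (A + B))]; take determinants. *)
Lemma char_poly_add_orth (R : comNzRingType) n (A B : 'M[R]_n) :
  A *m B = 0 -> 'X^n * char_poly (A + B) = char_poly A * char_poly B.
Proof.
move=> AB0; rewrite /char_poly -det_mulmx -det_scalar -det_mulmx.
congr (\det _); rewrite /char_poly_mx mulmxBl !mulmxBr -map_mxM AB0 map_mx0.
rewrite subr0 map_mxD mulmxDr opprD addrA !mul_scalar_mx mul_mx_scalar.
by rewrite addrAC.
Qed.

(** By the factorisation of characteristic polynomials, the spectrum of [A + B]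
    padded with [n] zeros is the union of the spectra of [A] and [B]. *)
Lemma matrix_energy_add_orth (R : rcfType) n (A B : 'M[R]_n) :
  A^T = A -> B^T = B -> A *m B = 0 ->
  matrix_energy (A + B) = matrix_energy A + matrix_energy B.
Proof.
move=> sA sB AB0.
have sAB : (A + B)^T = A + B by rewrite linearD /= sA sB.
have /prod_XsubC_eq eAB :
    \prod_(x <- nseq n 0 ++ spectrum (A + B)) ('X - x%:P) =
    \prod_(x <- spectrum A ++ spectrum B) ('X - x%:P).
  rewrite !big_cat /= -!spectrum_sym // -char_poly_add_orth //.
  by rewrite big_nseq subr0 -Monoid.iteropE.
have := perm_big _ eAB : \sum_(x <- _) `|x| = \sum_(x <- _) `|x|.
rewrite !big_cat /= => <-.
by rewrite big_nseq normr0 iter_addr addr0 mul0rn add0r.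
Qed.

(** * Positive semidefinite matrices *)

(** Positive semidefinite symmetric matrices; the quadratic form is evaluated on
    row vectors. *)
Definition psd (R : rcfType) n (M : 'M[R]_n) : Prop :=
  M^T = M /\ forall v : 'rV_n, 0 <= (v *m M *m v^T) 0 0.

Lemma row_norm_ge0 (R : rcfType) n (v : 'rV[R]_n) : 0 <= (v *m v^T) 0 0.
Proof. by rewrite mxE sumr_ge0 // => i _; rewrite mxE -expr2 sqr_ge0. Qed.

Lemma row_norm_gt0 (R : rcfType) n (v : 'rV[R]_n) :
  v != 0 -> 0 < (v *m v^T) 0 0.
Proof.
move=> v0; rewrite lt0r row_norm_ge0 andbT; apply: contra v0 => /eqP s0.
apply/eqP; apply: row_mul_tr_eq0; apply/matrixP => i j.
by rewrite !ord1 s0 mxE.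
Qed.

Lemma psd_gram (R : rcfType) m n (B : 'M[R]_(m, n)) : psd (B^T *m B).
Proof.
split=> [|v]; first by rewrite trmx_mul trmxK.
have -> : v *m (B^T *m B) *m v^T = (v *m B^T) *m (v *m B^T)^T.
  by rewrite trmx_mul trmxK !mulmxA.
exact: row_norm_ge0.
Qed.

Lemma psdZ (R : rcfType) n (a : R) (M : 'M[R]_n) :
  0 <= a -> psd M -> psd (a *: M).
Proof.
move=> a0 [sM pM]; split=> [|v]; first by rewrite linearZ /= sM.
by rewrite -scalemxAr -scalemxAl mxE mulr_ge0.
Qed.

Lemma psd_const1 (R : rcfType) n : psd (const_mx 1 : 'M[R]_n).
Proof.
suff -> : const_mx 1 = (const_mx 1 : 'rV[R]_n)^T *m (const_mx 1 : 'rV[R]_n).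
  exact: psd_gram.
by apply/matrixP => i j; rewrite !mxE big_ord1 !mxE mulr1.
Qed.

Lemma psd_diag_ge0 (R : rcfType) n (M : 'M[R]_n) i : psd M -> 0 <= M i i.
Proof.
case=> _ /(_ (delta_mx 0 i)).
by rewrite -rowE trmx_delta -colE !mxE.
Qed.

Lemma psd_eigenvalue_ge0 (R : rcfType) n (M : 'M[R]_n) a :
  psd M -> eigenvalue M a -> 0 <= a.
Proof.
move=> [_ pM] /eigenvalueP [v vM v0]; have := pM v.
by rewrite vM -scalemxAl mxE pmulr_lge0 // row_norm_gt0.
Qed.

Lemma matrix_energy_psd (R : rcfType) n (M : 'M[R]_n) :
  psd M -> matrix_energy M = \tr M.
Proof.
move=> pM; rewrite -sum_spectrum_sym; last by case: pM.
rewrite /matrix_energy big_seq [RHS]big_seq; apply: eq_bigr => x.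
by rewrite mem_spectrum => /(psd_eigenvalue_ge0 pM)/ger0_norm.
Qed.

Lemma matrix_energy_opp_psd (R : rcfType) n (M : 'M[R]_n) :
  psd M -> matrix_energy (- M) = \tr M.
Proof.
move=> pM; have <- : - \tr (- M) = \tr M by rewrite linearN opprK.
rewrite -sum_spectrum_sym; last first.
  by case: pM => sM _; rewrite linearN /= sM.
rewrite -sumrN /matrix_energy big_seq [RHS]big_seq; apply: eq_bigr => x.
rewrite mem_spectrum => /eigenvalueP [v vM v0].
have : eigenvalue M (- x).
  by apply/eigenvalueP; exists v; rewrite // scaleNr -vM mulmxN opprK.
by move/(psd_eigenvalue_ge0 pM); rewrite oppr_ge0 => /ler0_norm.
Qed.

(** * Moore-Penrose inverses of symmetric matrices *)

Lemma mpinv_eq (R : rcfType) m n (A : 'M[R]_(m, n)) X :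
  penrose A X -> mpinv A = X.
Proof. exact: penrose_uniq (mpinvP A). Qed.

Lemma mpinv_sym (R : rcfType) n (M : 'M[R]_n) :
  M^T = M -> (mpinv M)^T = mpinv M.
Proof.
move=> sM; apply/esym/mpinv_eq.
case/and4P: (mpinvP M) => /eqP X1 /eqP X2 /eqP X3 /eqP X4.
have e1 : M *m (mpinv M)^T = mpinv M *m M by rewrite -X4 trmx_mul sM.
have e2 : (mpinv M)^T *m M = M *m mpinv M by rewrite -X3 trmx_mul sM.
apply/and4P; split; apply/eqP.
- by have := congr1 trmx X1; rewrite !trmx_mul sM mulmxA.
- by have := congr1 trmx X2; rewrite !trmx_mul sM mulmxA.
- by rewrite e1 X4.
- by rewrite e2 X3.
Qed.

Lemma psd_mpinv (R : rcfType) n (M : 'M[R]_n) : psd M -> psd (mpinv M).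
Proof.
move=> [sM pM]; have sX := mpinv_sym sM; split=> // v.
case/and4P: (mpinvP M) => _ /eqP X2 _ _; have := pM (v *m mpinv M).
by rewrite trmx_mul sX !mulmxA -(mulmxA v) -(mulmxA v) X2.
Qed.

(** The Moore-Penrose inverse of [A] kills the kernel of the transpose of [A]. *)
Lemma mpinv_ker (R : rcfType) m n p (A : 'M[R]_(m, n)) (u : 'M[R]_(m, p)) :
  A^T *m u = 0 -> mpinv A *m u = 0.
Proof.
move=> Au0; case/and4P: (mpinvP A) => _ /eqP X2 /eqP X3 _.
by rewrite -X2 -(mulmxA _ A) -X3 trmx_mul -!mulmxA Au0 !mulmx0.
Qed.

(** * Laplacians and resistance matrices *)

Lemma natr_degree (R : rcfType) n (G : sgraph n) i :
  (degree G i)%:R = \sum_j (G i j)%:R :> R.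
Proof.
rewrite /degree -sum1_card natr_sum big_mkcond /=; apply: eq_bigr => j _.
by rewrite inE; case: (G i j).
Qed.

Lemma laplacianE (R : rcfType) n (G : sgraph n) i j :
  laplacian R G i j = (degree G i)%:R *+ (i == j) - (G i j)%:R.
Proof. by rewrite !mxE. Qed.

Lemma laplacian_sym (R : rcfType) n (G : sgraph n) :
  (laplacian R G)^T = laplacian R G.
Proof.
apply/matrixP => i j; rewrite mxE !laplacianE adj_sym eq_sym.
by case: eqP => [->|].
Qed.

Lemma laplacian_const (R : rcfType) n p (G : sgraph n) :
  laplacian R G *m (const_mx 1 : 'M_(n, p)) = 0.
Proof.
apply/matrixP => i j; rewrite !mxE.
under eq_bigr do rewrite [const_mx _ _ _]mxE mulr1 laplacianE.
rewrite sumrB -natr_degree (bigD1 i) //= eqxx big1 ?addr0 ?subrr // => l.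
by rewrite eq_sym => /negPf ->.
Qed.

(** The quadratic form is half the sum of [a i j * (v i - v j) ^+ 2] over all
    ordered pairs. *)
Lemma laplacian_psd (R : rcfType) n (G : sgraph n) : psd (laplacian R G).
Proof.
split=> [|v]; first exact: laplacian_sym.
pose a i j : R := (G i j)%:R.
have aC i j : a i j = a j i by rewrite /a adj_sym.
have Lv : (v *m laplacian R G *m v^T) 0 0 =
          \sum_i \sum_j (a i j * v 0 i ^+ 2 - a i j * v 0 i * v 0 j).
  rewrite mxE; apply: eq_bigr => i _.
  rewrite mxE [v^T _ _]mxE sumrB -mulr_suml -natr_degree mulr_suml.
  under eq_bigr do rewrite laplacianE mulrBr mulrBl.
  rewrite sumrB; congr (_ - _); last first.
    by apply: eq_bigr => j _; rewrite -/(a j i) aC; ring.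
  rewrite (bigD1 i) //= eqxx big1 ?addr0; first by rewrite mulr1n; ring.
  by move=> j /negPf ->; rewrite mulr0n; ring.
(* Twice the form, with the summation indices exchanged in one copy, is a sum
   of squares. *)
rewrite -(pmulrn_lge0 _ (ltn0Sn 1)) mulr2n {1}Lv Lv [X in X + _]exchange_big.
rewrite /= -big_split sumr_ge0 // => i _; rewrite -big_split sumr_ge0 //= => j _.
suff -> : a j i * v 0 j ^+ 2 - a j i * v 0 j * v 0 i +
          (a i j * v 0 i ^+ 2 - a i j * v 0 i * v 0 j)
        = a i j * (v 0 i - v 0 j) ^+ 2.
  by rewrite mulr_ge0 ?ler0n ?sqr_ge0.
by rewrite (aC j i); ring.
Qed.

Lemma sum_mpinv_laplacian (R : rcfType) n (G : sgraph n) i :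
  \sum_j mpinv (laplacian R G) i j = 0.
Proof.
have : laplacian R G *m (const_mx 1 : 'cV_n) = 0 by exact: laplacian_const.
rewrite -{1}laplacian_sym => /mpinv_ker /matrixP /(_ i 0).
rewrite mxE [RHS]mxE => e0; rewrite -[RHS]e0.
by apply: eq_bigr => j _; rewrite mxE mulr1.
Qed.

(** The [j]-th row sum [k] of the resistance matrix is [n * X j j + \tr X], with
    [X] the Moore-Penrose inverse; so [X j j] does not depend on [j], and the
    trace is [n] times it. *)
Lemma mpinv_diag_of_resistance_regular (R : rcfType) n (G : sgraph n) (k : R) i :
  (0 < n)%N -> resistance_regular G k ->
  mpinv (laplacian R G) i i = k / (2 * n%:R).
Proof.
move=> n0 kG; set X := mpinv _; have nz : n%:R != 0 :> R by rewrite pnatr_eq0 -lt0n.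
have row j : n%:R * X j j + \tr X = k.
  rewrite -(kG j); under eq_bigr do rewrite mxE.
  rewrite sumrB -mulr_sumr sum_mpinv_laplacian mulr0 subr0 big_split /=.
  by rewrite sumr_const card_ord mulr_natl.
have cst j : X j j = X i i.
  by apply: (mulfI nz); apply: (addIr (\tr X)); rewrite !row.
have := row i; rewrite /mxtrace; under eq_bigr do rewrite cst.
rewrite sumr_const card_ord -(mulr_natl (X i i)) => <-.
by field; rewrite nz.
Qed.

Lemma resistance_matrix_const_diag (R : rcfType) n (G : sgraph n) (d : R) :
  (forall i, mpinv (laplacian R G) i i = d) ->
  resistance_matrix R G = (2 * d) *: const_mx 1 - 2 *: mpinv (laplacian R G).
Proof. by move=> dG; apply/matrixP => i j; rewrite !mxE !dG; ring. Qed.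

Lemma mpinv_laplacian_const_diag_ge0 (R : rcfType) n (G : sgraph n) (d : R) :
  (0 < n)%N -> (forall i, mpinv (laplacian R G) i i = d) -> 0 <= d.
Proof.
move=> n0 /(_ (Ordinal n0)) <-; apply: psd_diag_ge0.
exact/psd_mpinv/laplacian_psd.
Qed.

Lemma resistance_energy_const_diag (R : rcfType) n (G : sgraph n) (d : R) :
  (0 < n)%N -> (forall i, mpinv (laplacian R G) i i = d) ->
  resistance_energy R G = 4 * n%:R * d.
Proof.
move=> n0 dG; have d0 := mpinv_laplacian_const_diag_ge0 n0 dG.
have pX := psd_mpinv (laplacian_psd R G).
have pJ : psd ((2 * d) *: const_mx 1 : 'M_n).
  by apply: psdZ; [rewrite mulr_ge0 | exact: psd_const1].
have p2X : psd (2 *: mpinv (laplacian R G)) by apply: psdZ.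
rewrite /resistance_energy (resistance_matrix_const_diag dG).
rewrite -/(matrix_energy _) matrix_energy_add_orth.
- have trJ : \tr (const_mx 1 : 'M[R]_n) = n%:R.
    rewrite /mxtrace; under eq_bigr do rewrite mxE.
    by rewrite sumr_const card_ord.
  have trX : \tr (mpinv (laplacian R G)) = n%:R * d.
    rewrite /mxtrace; under eq_bigr do rewrite dG.
    by rewrite sumr_const card_ord mulr_natl.
  by rewrite matrix_energy_psd // matrix_energy_opp_psd // !mxtraceZ trJ trX; ring.
- by case: pJ.
- by case: p2X => s2X _; rewrite linearN /= s2X.
rewrite mulmxN -scalemxAl -scalemxAr.
suff -> : (const_mx 1 : 'M_n) *m mpinv (laplacian R G) = 0.
  by rewrite !scaler0 oppr0.
apply: trmx_inj; rewrite trmx_mul trmx_const (proj1 pX) trmx0.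
by apply: mpinv_ker; rewrite laplacian_sym laplacian_const.
Qed.

Lemma largest_resistance_eigenvalue (R : rcfType) n (G : sgraph n) (k : R) :
  (0 < n)%N -> resistance_regular G k ->
  largest_eigenvalue (resistance_matrix R G) = k.
Proof.
move=> n0 kG; pose d := k / (2 * n%:R).
have nz : n%:R != 0 :> R by rewrite pnatr_eq0 -lt0n.
have dG i : mpinv (laplacian R G) i i = d.
  exact: mpinv_diag_of_resistance_regular.
have k_ge0 : 0 <= k.
  have -> : k = 2 * n%:R * d by rewrite /d; field.
  by apply: mulr_ge0 (mpinv_laplacian_const_diag_ge0 n0 dG); rewrite mulr_ge0 ?ler0n.
have [sX pX] := psd_mpinv (laplacian_psd R G).
have eR := resistance_matrix_const_diag dG.
have sR : (resistance_matrix R G)^T = resistance_matrix R G.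
  by rewrite eR linearB !linearZ /= trmx_const sX.
have R1 : resistance_matrix R G *m const_mx 1 = k *: (const_mx 1 : 'cV_n).
  apply/matrixP => i j; rewrite !mxE mulr1 -(kG i).
  by apply: eq_bigr => l _; rewrite [const_mx _ _ _]mxE mulr1.
have ev_k : eigenvalue (resistance_matrix R G) k.
  apply/eigenvalueP; exists (const_mx 1).
    by apply: trmx_inj; rewrite trmx_mul sR linearZ /= trmx_const.
  apply/eqP => /matrixP /(_ 0 (Ordinal n0)).
  by rewrite !mxE => /eqP; rewrite oner_eq0.
have ev_le a : eigenvalue (resistance_matrix R G) a -> a <= k.
  move=> /eigenvalueP [v vR v0].
  have : a *: (v *m (const_mx 1 : 'cV_n)) = k *: (v *m const_mx 1).
    by rewrite scalemxAl -vR -mulmxA R1 scalemxAr.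
  (* An eigenvector that is not orthogonal to the all-ones vector has eigenvalue
     [k]; on the others the resistance matrix is [- 2 X]. *)
  have [v1 _|v1] := eqVneq (v *m (const_mx 1 : 'cV_n)) 0; last first.
    by move/eqP; rewrite -subr_eq0 -scalerBl scaler_eq0 (negPf v1) orbF
       subr_eq0 => /eqP ->.
  have vJ : v *m (const_mx 1 : 'M_n) = 0.
    have -> : const_mx 1 = (const_mx 1 : 'cV[R]_n) *m (const_mx 1 : 'rV_n).
      by apply/matrixP => i j; rewrite !mxE big_ord1 !mxE mulr1.
    by rewrite mulmxA v1 mul0mx.
  apply: le_trans k_ge0; rewrite -(pmulr_lle0 _ (row_norm_gt0 v0)).
  have -> : a * (v *m v^T) 0 0 = - (2 * (v *m mpinv (laplacian R G) *m v^T) 0 0).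
    have := congr1 (fun w : 'rV_n => (w *m v^T) 0 0) vR; rewrite -scalemxAl.
    rewrite [RHS]mxE => <-.
    by rewrite eR mulmxBr -!scalemxAr vJ scaler0 sub0r mulNmx -scalemxAl !mxE.
  by rewrite oppr_le0 mulr_ge0.
apply/eqP; rewrite eq_le largest_eigenvalue_ge // andbT.
apply: ev_le; rewrite -mem_spectrum /largest_eigenvalue.
by move: ev_k; rewrite -mem_spectrum; case: (spectrum _) => //= x s _; exact: mem_head.
Qed.

(** * The double graph *)

(** The matrix acting as [2 P] on the vectors [(x, x)] and as [2 Q] on the
    vectors [(x, - x)]. *)
Definition swap_block (R : rcfType) n (P Q : 'M[R]_n) : 'M[R]_(n + n) :=
  block_mx (P + Q) (P - Q) (P - Q) (P + Q).

Lemma mul_swap_block (R : rcfType) n (P Q P' Q' : 'M[R]_n) :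
  swap_block P Q *m swap_block P' Q' =
  swap_block (2 *: (P *m P')) (2 *: (Q *m Q')).
Proof.
rewrite /swap_block mulmx_block !mulmxDl !mulmxDr !mulNmx !mulmxN !scaler_nat.
by congr block_mx; apply/matrixP => i j; rewrite 8!mxE !mxE; ring.
Qed.

Lemma tr_swap_block (R : rcfType) n (P Q : 'M[R]_n) :
  (swap_block P Q)^T = swap_block P^T Q^T.
Proof. by rewrite /swap_block tr_block_mx !linearD !linearN. Qed.

Lemma double_graph_degree n (G : sgraph n) r i :
  regular_graph G r -> degree (double_graph G) i = (2 * r)%N.
Proof.
move=> rG; pose u := match split i with inl l | inr l => l end.
have iE y : double_adj G i y = match split y with inl j | inr j => G u j end.
  rewrite /double_adj /u.
  by case: (split i) => l; case: (split y) => j //; rewrite adj_sym.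
have deg_u : (\sum_j (if G u j then 1 else 0) = r)%N.
  rewrite -(rG u) /degree -sum1_card [RHS]big_mkcond /=.
  by apply: eq_bigr => j _; rewrite inE.
rewrite mul2n -addnn -{1}deg_u -deg_u /degree -sum1_card big_mkcond.
rewrite big_split_ord /=; congr (_ + _)%N; apply: eq_bigr => j _;
  by rewrite inE /= iE ?(unsplitK (inl j)) ?(unsplitK (inr j)).
Qed.

Lemma laplacian_double_graph (R : rcfType) n (G : sgraph n) r :
  regular_graph G r ->
  laplacian R (double_graph G) = swap_block (laplacian R G) r%:R%:M.
Proof.
move=> rG; apply/matrixP => x y; rewrite laplacianE (double_graph_degree x rG).
rewrite -(splitK x) -(splitK y) /swap_block /= /double_adj !unsplitK.
case: (split x) => i; case: (split y) => j /=;
  rewrite ?(block_mxEul, block_mxEur, block_mxEdl, block_mxEdr) ?mxE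
    ?eq_lshift ?eq_rshift ?eq_lrshift ?eq_rlshift ?rG ?natrM 1?(adj_sym G j i);
  by case: (i == j); rewrite ?mulr1n ?mulr0n; ring.
Qed.

Lemma mpinv_laplacian_double (R : rcfType) n (G : sgraph n) r :
  (0 < r)%N -> regular_graph G r ->
  mpinv (laplacian R (double_graph G)) =
  swap_block (4^-1 *: mpinv (laplacian R G)) ((4 * r%:R)^-1)%:M.
Proof.
move=> r0 rG; rewrite (laplacian_double_graph R rG); apply: mpinv_eq.
have rz : r%:R != 0 :> R by rewrite pnatr_eq0 -lt0n.
case/and4P: (mpinvP (laplacian R G)) => /eqP X1 /eqP X2 /eqP X3 /eqP X4.
apply/and4P; split; apply/eqP; rewrite !mul_swap_block ?tr_swap_block.
- rewrite -!scalemxAr -?scalemxAl X1 -!scalar_mxM !scale_scalar_mx !scalerA.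
  by congr swap_block; [rewrite -[RHS]scale1r; congr (_ *: _) | congr _%:M]; field.
- rewrite -!scalemxAl -?scalemxAr -?scalemxAl X2 -!scalar_mxM !scale_scalar_mx !scalerA.
  by congr swap_block; [congr (_ *: _) | congr _%:M]; field.
- by rewrite -!scalemxAr -scalar_mxM scale_scalar_mx tr_scalar_mx scalerA linearZ /= X3.
- by rewrite -!scalemxAl -scalar_mxM scale_scalar_mx tr_scalar_mx scalerA linearZ /= X4.
Qed.

Lemma mpinv_diag_double (R : rcfType) n (G : sgraph n) r (d : R) i :
  (0 < r)%N -> regular_graph G r -> (forall j, mpinv (laplacian R G) j j = d) ->
  mpinv (laplacian R (double_graph G)) i i = d / 4 + (4 * r%:R)^-1.
Proof.
move=> r0 rG dG; rewrite (mpinv_laplacian_double R r0 rG) -(splitK i).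
case: (split i) => j /=; rewrite ?block_mxEul ?block_mxEdr !mxE dG eqxx mulr1n;
  by rewrite mulrC.
Qed.

Lemma connected_regular_degree_gt0 n (G : sgraph n) r :
  (1 < n)%N -> connected_graph G -> regular_graph G r -> (0 < r)%N.
Proof.
move=> n1 cG rG; pose i := Ordinal (ltnW n1); pose j := Ordinal n1.
rewrite -(rG i) /degree card_gt0; apply/set0Pn.
case/connectP: (cG i j) => [[|l p] /=]; first by move=> _ /(congr1 val).
by case/andP => il _ _; exists l; rewrite inE.
Qed.

Theorem corollary5p1 (R : rcfType) (n : nat) (G : sgraph n) (r : nat) (k : R) :
  (1 < n)%N ->
  connected_graph G ->
  regular_graph G r ->
  resistance_regular G k ->
  resistance_energy R (double_graph G) =
    largest_eigenvalue (resistance_matrix R G) + 2 * n%:R / r%:R.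
Proof.
move=> n1 cG rG kG; have n0 := ltnW n1.
have r0 := connected_regular_degree_gt0 n1 cG rG.
have nz : n%:R != 0 :> R by rewrite pnatr_eq0 -lt0n.
have rz : r%:R != 0 :> R by rewrite pnatr_eq0 -lt0n.
have dG i := mpinv_diag_of_resistance_regular i n0 kG.
have d2G i := mpinv_diag_double i r0 rG dG.
rewrite (largest_resistance_eigenvalue n0 kG).
rewrite (resistance_energy_const_diag _ d2G) ?addn_gt0 ?n0 //.
by rewrite natrD; field; rewrite nz rz.
Qed.
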